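(* Let $n\ge 2$ and let $\lambda\in\mathbb{R}^n$ satisfy $\lambda_2\ge\lambda_3\ge\dots\ge\lambda_n\ge 0$, with $\lambda_i-\lambda_j\in\mathbb{Z}$ and $2\lambda_i\in\mathbb{Z}$ for $2\le i,j\le n$. Suppose that one of the following holds: (i) $\lambda=(\lambda_1,\tfrac12,\dots,\tfrac12)$ and $\lambda_1\le 1-n$; or (ii) $1\le\lambda_2=\dots=\lambda_p>\lambda_{p+1}$ for some $2\le p\le n$ (the condition $\lambda_p>\lambda_{p+1}$ being void if $p=n$), and $\lambda_1+\lambda_2\le 1+p-2n$. Then the Dirac inequality $$\|(\lambda-s)^++\rho\|^2\ge\|\lambda+\rho\|^2$$ holds for every Schmid module $s=s_{a,b}=(2b+a,a,0,\dots,0)$, where $a,b\ge 0$ are integers.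
   Context: This is the case $\mathfrak{g}_0=\mathfrak{so}(2,2n-1)$. Here $\rho=(n-\tfrac12,n-\tfrac32,\dots,\tfrac12)$ and $\|\cdot\|$ is the standard Euclidean norm on $\mathbb{R}^n$. The Weyl group $W_{\mathfrak{k}}$ is generated by the reflections in $\varepsilon_i\pm\varepsilon_j$, $2\le i<j\le n$, and in $\varepsilon_i$, $2\le i\le n$, so it acts by all permutations and sign changes of the coordinates $2,\dots,n$ (fixing the first coordinate). For $\mu\in\mathbb{R}^n$, $\mu^+$ denotes the unique $W_{\mathfrak{k}}$-conjugate of $\mu$ satisfying $\mu_2\ge\mu_3\ge\dots\ge\mu_n\ge 0$. Schmid modules are identified with the $n$-tuples $s_{a,b}=(2b+a,a,0,\dots,0)$ with integers $a,b\ge 0$. *)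

(* Defs.v *)
From HB Require Import structures.
From mathcomp Require Import all_boot all_order all_fingroup all_algebra.
From mathcomp Require Import ring lra.
From mathcomp Require Import boolp classical_sets reals.

Set Implicit Arguments.
Unset Strict Implicit.
Unset Printing Implicit Defensive.

Import Order.TTheory GRing.Theory Num.Theory.
Local Open Scope ring_scope.

(* Elements of R^n are row vectors.  Coordinates of 'rV_n are numbered from 0;
   [crd mu k] is the coordinate mu_k in the numbering from 1 and is only
   meaningful for 1 <= k <= n. *)
Definition crd (R : realType) (n : nat) (mu : 'rV[R]_n) (k : nat) : R :=
  if insub k.-1 is Some i then mu 0 i else 0.

Definition dotr (R : realType) (n : nat) (u v : 'rV[R]_n) : R :=
  \sum_(i < n) u 0 i * v 0 i.

(* MathComp-Analysis equips 'rV_n with the sup norm, hence this definition. *)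
Definition enorm (R : realType) (n : nat) (u : 'rV[R]_n) : R :=
  Num.sqrt (dotr u u).

Definition eps (R : realType) (n : nat) (k : nat) : 'rV[R]_n :=
  \row_(i < n) (i.+1 == k)%:R.

Definition reflection (R : realType) (n : nat) (alpha v : 'rV[R]_n) : 'rV[R]_n :=
  v - (2 * dotr v alpha / dotr alpha alpha) *: alpha.

Inductive kroot (R : realType) (n : nat) : 'rV[R]_n -> Prop :=
| kroot_add i j : (2 <= i)%N -> (i < j)%N -> (j <= n)%N ->
    kroot (eps R n i + eps R n j)
| kroot_sub i j : (2 <= i)%N -> (i < j)%N -> (j <= n)%N ->
    kroot (eps R n i - eps R n j)
| kroot_short i : (2 <= i)%N -> (i <= n)%N -> kroot (eps R n i).

(* Reflections are involutions, so the group that they generate consists of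
   their finite compositions. *)
Inductive Wk (R : realType) (n : nat) : ('rV[R]_n -> 'rV[R]_n) -> Prop :=
| Wk_id : Wk id
| Wk_refl alpha w : kroot alpha -> Wk w -> Wk (reflection alpha \o w).

Definition Wk_conj (R : realType) (n : nat) (mu nu : 'rV[R]_n) : Prop :=
  exists2 w, Wk w & nu = w mu.

Definition kdominant (R : realType) (n : nat) (mu : 'rV[R]_n) : Prop :=
  (forall i, (2 <= i)%N -> (i < n)%N -> crd mu i.+1 <= crd mu i) /\
  0 <= crd mu n.

(* The element selected exists and is unique when n >= 2: see [kplus_spec] and
   [kdominant_conj_unique]. *)
Definition kplus (R : realType) (n : nat) (mu : 'rV[R]_n) : 'rV[R]_n :=
  xget 0 [set nu | Wk_conj mu nu /\ kdominant nu]%classic.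

Definition rho (R : realType) (n : nat) : 'rV[R]_n :=
  \row_(i < n) (n%:R - 2^-1 - i%:R).

Definition schmid (R : realType) (n a b : nat) : 'rV[R]_n :=
  (2 * b + a)%N%:R *: eps R n 1 + a%:R *: eps R n 2.

Section Dominant.
Variables (R : realType) (n : nat).
Implicit Types (mu nu : 'rV[R]_n) (i j t : 'I_n).

Lemma crdE mu i : crd mu i.+1 = mu 0 i.
Proof. by rewrite /crd /= valK. Qed.

Lemma epsE i t : eps R n i.+1 0 t = (t == i)%:R.
Proof. by rewrite mxE eqSS. Qed.

Lemma dotrDr mu nu nu' : dotr mu (nu + nu') = dotr mu nu + dotr mu nu'.
Proof.
by rewrite /dotr -big_split; apply: eq_bigr => k _; rewrite !mxE mulrDr.
Qed.

Lemma dotrNr mu nu : dotr mu (- nu) = - dotr mu nu.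
Proof. by rewrite /dotr -sumrN; apply: eq_bigr => k _; rewrite !mxE mulrN. Qed.

Lemma dotr_eps mu i : dotr mu (eps R n i.+1) = mu 0 i.
Proof.
rewrite /dotr (bigD1 i) //= big1 => [|k ki]; rewrite epsE ?eqxx.
  by rewrite mulr1 addr0.
by rewrite (negbTE ki) mulr0.
Qed.

Lemma reflection_short mu i t :
  reflection (eps R n i.+1) mu 0 t = if t == i then - mu 0 t else mu 0 t.
Proof.
rewrite /reflection 4!mxE !dotr_eps !epsE eqxx -(epsE i) epsE.
by case: eqP => [->|_] /=; lra.
Qed.

Lemma reflectionE alpha mu t : dotr alpha alpha = 2 ->
  reflection alpha mu 0 t = mu 0 t - dotr mu alpha * alpha 0 t.
Proof. by move=> a2; rewrite /reflection a2 !mxE; field. Qed.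

Lemma reflection_sub mu i j t : i != j ->
  reflection (eps R n i.+1 - eps R n j.+1) mu 0 t = mu 0 (tperm i j t).
Proof.
move=> ij; rewrite reflectionE; last first.
  rewrite dotrDr dotrNr !dotr_eps !mxE !eqSS !eqxx !val_eqE.
  by rewrite [j == i]eq_sym (negbTE ij) /=; lra.
rewrite dotrDr dotrNr !dotr_eps !mxE !eqSS !val_eqE.
case: tpermP => [->|->|/eqP/negbTE-> /eqP/negbTE->] /=; last by lra.
- by rewrite eqxx (negbTE ij) /=; lra.
- by rewrite eqxx [j == i]eq_sym (negbTE ij) /=; lra.
Qed.

Lemma reflection_add mu i j t : i != j ->
  reflection (eps R n i.+1 + eps R n j.+1) mu 0 t =
  if (t == i) || (t == j) then - mu 0 (tperm i j t) else mu 0 t.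
Proof.
move=> ij; rewrite reflectionE; last first.
  rewrite dotrDr !dotr_eps !mxE !eqSS !eqxx !val_eqE.
  by rewrite [j == i]eq_sym (negbTE ij) /=; lra.
rewrite dotrDr !dotr_eps !mxE !eqSS !val_eqE.
case: tpermP => [->|->|/eqP/negbTE-> /eqP/negbTE->] /=; last by lra.
- by rewrite eqxx (negbTE ij) /=; lra.
- by rewrite eqxx [j == i]eq_sym (negbTE ij) /=; lra.
Qed.

Lemma Wk_conj_refl mu : Wk_conj mu mu.
Proof. by exists id => //; constructor. Qed.

Lemma Wk_conj_step mu nu alpha :
  kroot alpha -> Wk_conj mu nu -> Wk_conj mu (reflection alpha nu).
Proof. by move=> ra [w Ww ->]; exists (reflection alpha \o w); [constructor|]. Qed.

Lemma kroot_ind_ord (P : 'rV[R]_n -> Prop) :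
  (forall i j, (0 < i)%N -> (i < j)%N -> P (eps R n i.+1 + eps R n j.+1)) ->
  (forall i j, (0 < i)%N -> (i < j)%N -> P (eps R n i.+1 - eps R n j.+1)) ->
  (forall i, (0 < i)%N -> P (eps R n i.+1)) ->
  forall alpha, kroot alpha -> P alpha.
Proof.
move=> Pa Ps Pe alpha; case=> [[|i] [|j] // i1 ij jn|[|i] [|j] // i1 ij jn|].
- exact: (Pa (Ordinal (ltn_trans (ij : i < j)%N jn)) (Ordinal jn)).
- exact: (Ps (Ordinal (ltn_trans (ij : i < j)%N jn)) (Ordinal jn)).
- by case=> // i i1 iN; apply: (Pe (Ordinal iN)).
Qed.

Lemma Wk_conj_perm mu nu : Wk_conj mu nu -> exists s : 'S_n,
  forall t, [/\ (0 < s t)%N = (0 < t)%N, `|nu 0 t| = `|mu 0 (s t)|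
             & t = 0%N :> nat -> nu 0 t = mu 0 t].
Proof.
move=> [w Ww ->]; elim: Ww => {w nu} [|alpha w ra _ [s IH]].
  by exists 1%g => t; rewrite perm1.
have tpos i j t : (0 < i)%N -> (0 < j)%N -> (0 < tperm i j t)%N = (0 < t)%N.
  by move=> i0 j0; case: tpermP => // ->; rewrite ?i0 ?j0.
rewrite /=; elim/kroot_ind_ord: ra => [i j i0 ij|i j i0 ij|i i0].
- have j0 : (0 < j)%N by apply: ltn_trans ij.
  have nij : i != j by rewrite -val_eqE neq_ltn ij.
  exists (tperm i j * s)%g => t; rewrite permM reflection_add //.
  have [h1 h2 _] := IH (tperm i j t); split; first by rewrite h1 tpos.
    rewrite -h2; case: tpermP => [->|->|/eqP/negbTE-> /eqP/negbTE->] //=.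
      by rewrite eqxx normrN.
    by rewrite eqxx orbT normrN.
  move=> t0; have [_ _ <- //] := IH t.
  by rewrite -!val_eqE /= t0 !ltn_eqF.
- have j0 : (0 < j)%N by apply: ltn_trans ij.
  have nij : i != j by rewrite -val_eqE neq_ltn ij.
  exists (tperm i j * s)%g => t; rewrite permM reflection_sub //.
  have [h1 h2 _] := IH (tperm i j t); split => //; first by rewrite h1 tpos.
  move=> t0; have [_ _ <- //] := IH t.
  by rewrite tpermD // -val_eqE /= t0 gtn_eqF.
- exists s => t; rewrite reflection_short; have [h1 h2 h3] := IH t.
  split => //; first by case: ifP; rewrite ?normrN.
  by move=> t0; rewrite -h3 // -val_eqE /= t0 ltn_eqF.
Qed.

Lemma kdominant_le mu i j : kdominant mu -> (0 < i)%N -> (i <= j)%N ->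
  mu 0 j <= mu 0 i.
Proof.
move=> [dm _] i0 ij; rewrite -!crdE.
move: (ltn_ord j); rewrite -(subnKC ij); elim: (j - i)%N => [|k IH] kn.
  by rewrite addn0.
rewrite addnS in kn *; apply: le_trans (IH (ltnW kn)).
by apply: dm => //; rewrite ltnS (leq_trans i0) // leq_addr.
Qed.

Lemma kdominant_ge0 mu i : kdominant mu -> (0 < i)%N -> 0 <= mu 0 i.
Proof.
move=> dmu i0; have nN : (n.-1 < n)%N by case: (n) i i0 => // -[].
have := dmu.2; rewrite -{2}(prednK (leq_trans _ nN)) // (crdE _ (Ordinal nN)).
move=> /le_trans; apply; apply: kdominant_le => //=.
by rewrite -ltnS prednK // (leq_trans _ nN).
Qed.

Lemma kdominant_conj_unique mu nu nu' :
  Wk_conj mu nu -> kdominant nu -> Wk_conj mu nu' -> kdominant nu' -> nu = nu'.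
Proof.
move=> /Wk_conj_perm[s hs] dn /Wk_conj_perm[s' hs'] dn'.
pose E := [seq t : 'I_n <- enum 'I_n | (0 < t)%N].
pose L (v : 'rV[R]_n) := [seq v 0 t | t <- E].
have EP t : (t \in E) = (0 < t)%N by rewrite mem_filter mem_enum andbT.
have permL v (u : 'S_n) : kdominant v ->
    (forall t, [/\ (0 < u t)%N = (0 < t)%N, `|v 0 t| = `|mu 0 (u t)|
             & t = 0%N :> nat -> v 0 t = mu 0 t]) ->
    perm_eq (L v) [seq `|mu 0 t| | t <- E].
  move=> dv hu.
  have -> : L v = [seq `|mu 0 t| | t <- map u E].
    rewrite -map_comp; apply/eq_in_map => t; rewrite EP => t0 /=.
    by have [_ <- _] := hu t; rewrite ger0_norm // kdominant_ge0.
  apply: perm_map; apply: uniq_perm.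
  - by rewrite (map_inj_uniq perm_inj) filter_uniq // enum_uniq.
  - by rewrite filter_uniq // enum_uniq.
  - move=> t; rewrite EP -[t](permKV u) mem_map; last exact: perm_inj.
    by rewrite EP; have [-> _ _] := hu ((u^-1)%g t).
have sortL v : kdominant v -> sorted >=%R (L v).
  move=> dv; rewrite sorted_map.
  have : sorted (fun i j => (i <= j)%N) E.
    apply: sorted_filter; first by move=> ? ? ?; apply: leq_trans.
    by have := iota_sorted 0 n; rewrite -val_enum_ord sorted_map.
  apply: (sub_in_sorted (P := [in E])); last exact/allP.
  by move=> i j; rewrite !EP => i0 j0 ij; apply: kdominant_le.
have LE : L nu = L nu'.
  apply: (sorted_eq _ _ (sortL _ dn) (sortL _ dn')).
  - by move=> x y z /= xy yz; apply: le_trans yz xy.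
  - by move=> x y /= xy; apply: le_anti; rewrite andbC.
  - by apply: perm_trans (permL _ _ dn hs) _; rewrite perm_sym (permL _ _ dn' hs').
apply/rowP => t; have [t0|t0] := posnP t.
  by have [_ _ ->] := hs t => //; have [_ _ ->] := hs' t.
by move/eq_in_map: LE => -> //; rewrite EP.
Qed.

Lemma kdominant_conj_exists mu : (2 <= n)%N ->
  exists2 nu, Wk_conj mu nu & kdominant nu.
Proof.
move=> n2.
have [nu c1 nn] : exists2 nu, Wk_conj mu nu &
    forall i, (0 < i)%N -> (i < n)%N -> 0 <= nu 0 i.
  suff H k : exists2 nu, Wk_conj mu nu &
      forall i, (0 < i)%N -> (i < k)%N -> 0 <= nu 0 i by apply: H.
  elim: k => [|k [nu c IH]]; first by exists mu => //; apply: Wk_conj_refl.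
  have [kn|nk] := ltnP k n; last first.
    by exists nu => // i i0 _; apply: IH => //; apply: leq_trans nk.
  pose K := Ordinal kn.
  have [k0|k0] := posnP k.
    by exists nu => // i i0; rewrite k0 ltnS leqNgt i0.
  have [K0|K0] := leP 0 (nu 0 K).
    exists nu => // i i0; rewrite ltnS leq_eqVlt => /orP[/eqP ik|]; last exact: IH.
    by have -> : i = K by apply: val_inj.
  exists (reflection (eps R n K.+1) nu); first exact: Wk_conj_step (kroot_short _ _ _) c.
  move=> i i0 ik; rewrite reflection_short; case: eqP => [->|/eqP iK].
    by rewrite oppr_ge0 ltW.
  by apply: IH => //; rewrite ltn_neqAle -ltnS ik andbT.
have {}nn i : (0 < i)%N -> 0 <= nu 0 i by move=> i0; apply: nn.
suff [v c [vn vs]] : exists2 v, Wk_conj mu v & (forall i, (0 < i)%N -> 0 <= v 0 i) /\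
    forall i j, (0 < i)%N -> (i < n)%N -> (i <= j)%N -> v 0 j <= v 0 i.
  exists v => //; split=> [[|i] // i1 iN|]; last first.
    have nN : (n.-1 < n)%N by rewrite prednK // ltnW.
    rewrite -{2}(prednK (ltnW n2)) (crdE v (Ordinal nN)); apply: vn => /=.
    by rewrite -ltnS prednK // ltnW.
  rewrite (crdE v (Ordinal iN)) (crdE v (Ordinal (ltnW iN))).
  exact: vs.
suff H k : exists2 v, Wk_conj mu v & (forall i, (0 < i)%N -> 0 <= v 0 i) /\
    forall i j, (0 < i)%N -> (i < k)%N -> (i <= j)%N -> v 0 j <= v 0 i by apply: H.
elim: k => [|k [v c [vn vs]]]; first by exists nu.
have [kn|nk] := ltnP k n; last first.
  by exists v => //; split=> // i j i0 _; apply: vs => //; apply: leq_trans nk.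
pose K := Ordinal kn.
have [k0|k0] := posnP k.
  by exists v => //; split=> // i j i0; rewrite k0 ltnS leqNgt i0.
have [M kM Mmax] := @arg_maxP _ _ _ K (fun j => k <= j)%N (v 0) (leqnn k).
have M0 : (0 < M)%N by apply: leq_trans kM.
have [KM|KM] := eqVneq K M.
  exists v => //; split=> // i j i0; rewrite ltnS leq_eqVlt => /orP[/eqP ik ij|]; last exact: vs.
  have -> : i = M by rewrite -KM; apply: val_inj.
  by apply: Mmax; rewrite -ik.
exists (reflection (eps R n K.+1 - eps R n M.+1) v).
  apply: Wk_conj_step c; apply: kroot_sub => //.
  by rewrite ltnS ltn_neqAle kM andbT.
split=> [i i0|i j i0 ik ij]; rewrite !reflection_sub //.
  by apply: vn; case: tpermP => // ->.
have tk (u : 'I_n) : (k <= u)%N -> (k <= tperm K M u)%N by case: tpermP => // ->.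
move: ik; rewrite ltnS leq_eqVlt => /orP[/eqP ik|ik].
  have -> : i = K by apply: val_inj.
  by rewrite tpermL; apply: Mmax; apply: tk; rewrite -ik.
have -> : tperm K M i = i.
  by apply: tpermD; rewrite -val_eqE /= neq_ltn ?ik ?(leq_trans ik kM) orbT.
apply: vs => //; case: tpermP => // _; last exact: ltnW.
exact: leq_trans (ltnW ik) kM.
Qed.

Lemma kplus_spec mu : (2 <= n)%N ->
  Wk_conj mu (kplus mu) /\ kdominant (kplus mu).
Proof.
move=> n2; apply: (@xgetPex _ 0 [set nu | Wk_conj mu nu /\ kdominant nu]%classic).
by have [nu] := kdominant_conj_exists mu n2; exists nu.
Qed.

End Dominant.

(* Main.v *)
Require Import Defs.
From mathcomp Require Import all_boot all_order all_algebra.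
From mathcomp Require Import reals.
From mathcomp Require Import all_fingroup ring lra.
Import Order.TTheory GRing.Theory Num.Theory.
Local Open Scope ring_scope.

(** Let [mu := lambda - s] and [nu := mu^+], so that [nu] is a conjugate of
    [mu].  The group W_k acts by isometries, hence |nu| = |mu|, and expanding
    both squares gives
    [|nu + rho|^2 - |lambda + rho|^2
       = |mu|^2 - |lambda|^2 + 2 (nu - lambda, rho)].
    Everything on the right is explicit except [(nu, rho)].  Both [nu] and
    [rho] decrease along the coordinates 2, ..., n, so by the rearrangement
    inequality [(nu, rho)] can only drop when the absolute values of the
    coordinates of [mu] are arranged in another order ([kdominant_dot_rho]).
    It is therefore enough to pick one convenient arrangement.  As [mu] differs
    from [lambda], apart from the first coordinate, only in having
    [lambda_2 - a] in place of [lambda_2], it is natural to put this entry at a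
    position k with [lambda_k = lambda_2] and to leave the others where
    [lambda] has them; this is the estimate [dirac_gap].

    In case (ii) take the last such position, k = p, where [rho] is smallest,
    and bound [|lambda_2 - a|] below by [lambda_2 - a].  The hypotheses make
    [lambda_1 + n - 1/2] negative, so the terms in b are nonnegative, and what is left is at least
    [2 a^2 - 2 a (lambda_1 + lambda_2 + 2 n - p) >= 2 a^2 - 2 a], which is
    nonnegative because a is an integer.  In case (i) the new entry is
    [|1/2 - a|], at least 1/2, so k = 2 is the right place; the gap is then at
    least [(m^2 - m) + (a^2 - a)] with [m = 2 b + a]. *)

(** * Rearrangement *)

(** Induction on A: swapping values so that the largest index k of A becomes
    fixed does not decrease the sum, since it pairs the smallest value of [f]
    with the smallest value of [g]. *)
Lemma rearrangement (R : realDomainType) (n : nat) (f g : 'I_n -> R)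
    (A : {set 'I_n}) (s : 'S_n) :
  {in A &, forall i j : 'I_n, (i <= j)%N -> f j <= f i} ->
  {in A &, forall i j : 'I_n, (i <= j)%N -> g j <= g i} ->
  perm_on A s ->
  \sum_t f (s t) * g t <= \sum_t f t * g t.
Proof.
elim: {A}_.+1 {-2}A (ltnSn #|A|) s => // N IH A AN s fA gA sA.
have [A0|[i0 i0A]] := set_0Vmem A.
  have -> : s = 1%g.
    by apply/permP => t; rewrite perm1 (out_perm sA) // A0 inE.
  by apply: ler_sum => t _; rewrite perm1.
have [k kA kmax] := @arg_maxnP _ i0 [in A] (fun i : 'I_n => nat_of_ord i) i0A.
pose j := (s^-1)%g k.
have sj : s j = k by rewrite permKV.
have jA : j \in A by rewrite -(perm_closed _ sA) sj.
have skA : s k \in A by rewrite (perm_closed _ sA).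
pose s' := (s * tperm (s k) k)%g.
have s'k : s' k = k by rewrite permM tpermL.
have s'A : perm_on (A :\ k) s'.
  apply/subsetP => t; rewrite unfold_in; apply: contraR.
  rewrite in_setD1 negb_and negbK => /orP[/eqP->|tA]; first by rewrite s'k.
  rewrite permM (out_perm sA tA) tpermD //.
  - by apply: contraNneq tA => <-.
  - by apply: contraNneq tA => <-.
have {}IH : \sum_t f (s' t) * g t <= \sum_t f t * g t.
  apply: (IH (A :\ k)) => //.
  - by move: AN; rewrite (cardsD1 k) kA.
  - by move=> x y /setD1P[_ xA] /setD1P[_ yA]; apply: fA.
  - by move=> x y /setD1P[_ xA] /setD1P[_ yA]; apply: gA.
apply: le_trans IH.
have [jk|jk] := eqVneq j k.
  have sk : s k = k by rewrite -{1}jk.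
  by apply: ler_sum => t _; rewrite permM sk tperm1 perm1.
rewrite (bigD1 k) //= (bigD1 j) //= [leRHS](bigD1 k) //= [X in _ <= _ + X](bigD1 j) //=.
have -> : \sum_(i | (i != k) && (i != j)) f (s' i) * g i =
          \sum_(i | (i != k) && (i != j)) f (s i) * g i.
  apply: eq_bigr => t /andP[tk tj]; rewrite permM tpermD //.
  - by rewrite (inj_eq perm_inj) eq_sym.
  - by rewrite -sj (inj_eq perm_inj) eq_sym.
have -> : s' j = s k by rewrite permM sj tpermR.
rewrite s'k sj !addrA lerD2r.
have := mulr_ge0 (_ : 0 <= f (s k) - f k) (_ : 0 <= g j - g k).
rewrite !subr_ge0 => /(_ (fA _ _ skA kA (kmax _ skA)) (gA _ _ jA kA (kmax _ jA))).
lra.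
Qed.

(** * Dot products and conjugation *)

Lemma dotrC (R : realType) (n : nat) (u v : 'rV[R]_n) : dotr u v = dotr v u.
Proof. by apply: eq_bigr => t _; rewrite mulrC. Qed.

Lemma dotrZr (R : realType) (n : nat) (u v : 'rV[R]_n) (c : R) :
  dotr u (c *: v) = c * dotr u v.
Proof.
by rewrite /dotr mulr_sumr; apply: eq_bigr => t _; rewrite mxE mulrCA.
Qed.

Lemma enorm_sqr (R : realType) (n : nat) (u : 'rV[R]_n) :
  enorm u ^+ 2 = dotr u u.
Proof.
by rewrite sqr_sqrtr //; apply: sumr_ge0 => t _; rewrite -expr2 sqr_ge0.
Qed.

Lemma Wk_conj_dotr (R : realType) (n : nat) (mu nu : 'rV[R]_n) :
  Wk_conj mu nu -> dotr nu nu = dotr mu mu.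
Proof.
move=> /Wk_conj_perm[s hs].
rewrite /dotr [RHS](reindex_inj (@perm_inj _ s)); apply: eq_bigr => t _ /=.
have [_ nt _] := hs t.
by rewrite -!expr2 -[LHS]real_normK ?num_real // nt real_normK ?num_real.
Qed.

(** The vector [nu] lists the absolute values of the coordinates 2, ..., n of
    [mu] in decreasing order, so there [x] is bounded above by a rearrangement
    of [nu]; now use that [rho] is positive and decreasing.  The inequality in
    the last hypothesis lets [x] carry an entry of [mu] with either sign. *)
Lemma kdominant_dot_rho (R : realType) (n : nat) (mu nu x : 'rV[R]_n)
    (u : 'S_n) :
  Wk_conj mu nu -> kdominant nu -> perm_on [set t : 'I_n | (0 < t)%N] u ->
  (forall t : 'I_n, t = 0%N :> nat -> x 0 t = mu 0 t) ->
  (forall t : 'I_n, (0 < t)%N -> x 0 t <= `|mu 0 (u t)|) ->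
  dotr x (rho R n) <= dotr nu (rho R n).
Proof.
move=> /Wk_conj_perm[s hs] dn uA x0 xpos.
have sA : perm_on [set t : 'I_n | (0 < t)%N] s.
  apply/subsetP => t; rewrite unfold_in inE; apply: contraR.
  rewrite -eqn0Ngt => /eqP t0; rewrite -val_eqE /= t0.
  by have [] := hs t; rewrite t0 ltnn; case: (nat_of_ord (s t)).
have wA : perm_on [set t : 'I_n | (0 < t)%N] (u * s^-1)%g.
  by apply: perm_onM => //; apply: perm_onV.
have rho_ge0 (t : 'I_n) : 0 <= rho R n 0 t.
  rewrite mxE; have : (t.+1 <= n)%N by [].
  by rewrite -(ler_nat R) -natr1; lra.
apply: le_trans (rearrangement _ _ (nu 0) (rho R n 0) _ _ _ _ wA).
- apply: ler_sum => t _; apply: ler_wpM2r => //.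
  have [t0|t0] := posnP t.
    rewrite (out_perm wA) ?inE ?t0 // x0 //.
    by have [_ _ ->] := hs t.
  apply: le_trans (xpos _ t0) _; rewrite permM.
  have [h1 h2 _] := hs ((s^-1)%g (u t)); move: h1 h2; rewrite permKV => h1 <-.
  rewrite ger0_norm // kdominant_ge0 // -h1.
  by have := perm_closed t uA; rewrite !inE => ->.
- by move=> i j; rewrite !inE => i0 j0 ij; apply: kdominant_le.
- by move=> i j _ _ ij; rewrite !mxE lerD2l lerN2 ler_nat.
Qed.

(** * The estimate for one arrangement *)

(** The entry [lambda_2 - a] of [lambda - s] is moved to a position K that
    carries the same coordinate of [lambda]; there it contributes at least
    [lambda_2 + c] in absolute value, so [c] is the change at K. *)
Lemma dirac_gap (R : realType) (n : nat) (lambda : 'rV[R]_n) (O I K : 'I_n)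
    (a b : nat) (m c : R) :
  (2 <= n)%N -> O = 0%N :> nat -> I = 1%N :> nat -> (0 < K)%N ->
  lambda 0 K = lambda 0 I ->
  lambda 0 I + c <= `|lambda 0 I - a%:R| ->
  m = 2 * b%:R + a%:R ->
  m ^+ 2 - 2 * m * (lambda 0 O + rho R n 0 O)
    + (a%:R ^+ 2 - 2 * a%:R * lambda 0 I + 2 * c * rho R n 0 K)
  <= enorm (kplus (lambda - schmid R n a b) + rho R n) ^+ 2
     - enorm (lambda + rho R n) ^+ 2.
Proof.
move=> n2 O0 I1 K0 lK lc mE; rewrite !enorm_sqr.
set mu := lambda - _; have [cj dn] := kplus_spec mu n2.
set nu := kplus mu in cj dn *.
have schmidE : schmid R n a b = m *: eps R n O.+1 + a%:R *: eps R n I.+1.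
  by rewrite /schmid mE natrD natrM O0 I1.
have muE (t : 'I_n) : mu 0 t = lambda 0 t - m * (t == O)%:R - a%:R * (t == I)%:R.
  by rewrite /mu schmidE !mxE !eqSS opprD addrA.
pose x := lambda - m *: eps R n O.+1 + c *: eps R n K.+1.
have xE (t : 'I_n) : x 0 t = lambda 0 t - m * (t == O)%:R + c * (t == K)%:R.
  by rewrite /x !mxE !eqSS.
have posO (t : 'I_n) : (0 < t)%N -> (t == O) = false.
  by move=> t0; rewrite -val_eqE /= O0 gtn_eqF.
have dot_x : dotr x (rho R n) <= dotr nu (rho R n).
  apply: (@kdominant_dot_rho _ _ mu _ _ (tperm I K)) => //.
  - apply/subsetP => t; rewrite unfold_in inE.
    by case: tpermP => [->|->|]; rewrite ?I1 ?K0 ?eqxx.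
  - move=> t t0; rewrite xE muE.
    have -> : (t == K) = false by rewrite -val_eqE /= t0 ltn_eqF.
    have -> : (t == I) = false by rewrite -val_eqE /= t0 I1.
    by rewrite !mulr0 addr0 subr0.
  - move=> t t0; rewrite xE posO // mulr0 subr0.
    have -> : mu 0 (tperm I K t) = lambda 0 t - a%:R * (t == K)%:R.
      rewrite muE; case: tpermP => [->|->|/eqP/negbTE tI /eqP/negbTE tK].
      - by rewrite posO // mulr0 subr0 lK eq_sym.
      - by rewrite posO ?I1 // eqxx mulr0 subr0 lK eqxx.
      - by rewrite posO // tI tK !mulr0 !subr0.
    case: eqP => [->|_]; first by rewrite lK !mulr1.
    by rewrite !mulr0 addr0 subr0 ler_norm.
have : dotr x (rho R n) =
    dotr lambda (rho R n) - m * rho R n 0 O + c * rho R n 0 K.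
  rewrite dotrC /x !dotrDr dotrNr !dotrZr !dotr_eps.
  by rewrite [dotr _ lambda]dotrC.
have sqD (v w : 'rV[R]_n) :
    dotr (v + w) (v + w) = dotr v v + 2 * dotr v w + dotr w w.
  rewrite dotrDr [dotr _ v]dotrC [dotr _ w]dotrC !dotrDr [dotr w v]dotrC; lra.
have muSq : dotr mu mu =
    dotr lambda lambda - 2 * m * lambda 0 O - 2 * a%:R * lambda 0 I
    + m ^+ 2 + a%:R ^+ 2.
  rewrite /mu sqD !dotrNr [dotr (- _) _]dotrC dotrNr opprK schmidE sqD dotrDr.
  by rewrite !dotrZr !dotr_eps !mxE !eqSS !eqxx O0 I1 /=; ring.
move: dot_x; rewrite !sqD (Wk_conj_dotr _ _ _ _ cj) muSq => dot_x xrho.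
rewrite xrho in dot_x; lra.
Qed.

Lemma ler_natr_sqr (R : realType) (k : nat) : k%:R <= k%:R ^+ 2 :> R.
Proof. by rewrite -natrX ler_nat; case: k => // k; rewrite leq_pmulr. Qed.

(** * The Dirac inequality *)

Theorem theorem3p92 (R : realType) (n : nat) (hn : (2 <= n)%N)
    (lambda : 'rV[R]_n)
    (hdom : kdominant lambda)
    (hdiff : forall i j, (2 <= i <= n)%N -> (2 <= j <= n)%N ->
               crd lambda i - crd lambda j \is a Num.int)
    (hint : forall i, (2 <= i <= n)%N -> 2 * crd lambda i \is a Num.int)
    (hcase :
       ((forall i, (2 <= i <= n)%N -> crd lambda i = 1 / 2) /\
        crd lambda 1 <= 1 - n%:R)
       \/
       (exists p : nat,
          [/\ (2 <= p <= n)%N,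
              1 <= crd lambda 2,
              forall i, (2 <= i <= p)%N -> crd lambda i = crd lambda 2,
              (p < n)%N -> crd lambda p.+1 < crd lambda p
            & crd lambda 1 + crd lambda 2 <= 1 + p%:R - 2 * n%:R])) :
  forall a b : nat,
    enorm (kplus (lambda - schmid R n a b) + rho R n) ^+ 2
      >= enorm (lambda + rho R n) ^+ 2.
Proof.
move=> a b; rewrite -subr_ge0.
have n1 : (1 < n)%N by [].
pose O := Ordinal (ltnW n1); pose I := Ordinal n1.
have lO : crd lambda 1 = lambda 0 O by rewrite (crdE lambda O).
have lI : crd lambda 2 = lambda 0 I by rewrite (crdE lambda I).
have nR : 2 <= n%:R :> R by rewrite ler_nat.
have a0 := ler0n R a; have b0 := ler0n R b; have aa := ler_natr_sqr R a.
case: hcase => [[half l1]|[p [/andP[p2 pn] l2 lp _ l12]]].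
- have l2 : lambda 0 I = 1 / 2 by rewrite -lI half.
  (* |1/2 - a| exceeds 1/2 by a - 1 if a is positive, and by 0 otherwise. *)
  have lc : lambda 0 I + a.-1%:R <= `|lambda 0 I - a%:R|.
    rewrite l2; case: (a) => [|k] /=; first by rewrite addr0 subr0 ler_norm.
    by rewrite distrC -(natr1 k); apply: le_trans (ler_norm _); lra.
  apply: le_trans (dirac_gap _ _ _ O I I _ b _ _ hn _ _ _ _ lc erefl) => //.
  rewrite !mxE /= l2; rewrite lO in l1.
  (* With m = 2 b + a, the gap is linear in m^2 - m, a^2 - a and the two
     products below; rho_1 + lambda_1 is at most 1/2. *)
  have mm := ler_natr_sqr R (2 * b + a); rewrite natrD natrM in mm.
  have := mulr_ge0 (ler0n R a.-1) (_ : 0 <= n%:R - 2^-1 - 1).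
  move=> /(_ ltac:(lra)) cr.
  have := mulr_ge0 (_ : 0 <= 2 * b%:R + a%:R)
    (_ : 0 <= 1 / 2 - (lambda 0 O + (n%:R - 2^-1 - 0))).
  move=> /(_ ltac:(lra) ltac:(lra)); lra.
- have pK : (p.-1 < n)%N by rewrite prednK // ltnW.
  pose K := Ordinal pK.
  have K0 : (0 < K)%N by rewrite /= -ltnS prednK // ltnW.
  have lK : lambda 0 K = lambda 0 I.
    by rewrite -lI -(lp p) ?p2 ?leqnn // -(crdE lambda K) /= prednK // ltnW.
  have lc : lambda 0 I + (- a%:R) <= `|lambda 0 I - a%:R| by apply: ler_norm.
  apply: le_trans (dirac_gap _ _ _ O I K _ b _ _ hn _ _ K0 lK lc erefl) => //.
  have pR : p.-1%:R = p%:R - 1 :> R.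
    by rewrite -subn1 natrB // ltnW.
  rewrite !mxE /= pR; rewrite lO lI in l12 l2.
  have pnR : p%:R <= n%:R :> R by rewrite ler_nat.
  (* The gap is linear in the products below and in a^2 - a. *)
  have := mulr_ge0 b0 a0; have := mulr_ge0 b0 b0.
  have := mulr_ge0 b0 (_ : 0 <= - (lambda 0 O + (n%:R - 2^-1 - 0))).
  move=> /(_ ltac:(lra)).
  have := mulr_ge0 a0
    (_ : 0 <= 1 - (lambda 0 O + lambda 0 I + 2 * n%:R - p%:R)).
  move=> /(_ ltac:(lra)); lra.
Qed.
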